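(* Let $\mathcal{I}$ be a nontrivial admissible ideal of subsets of $\mathbb{N}$. The family $\mathfrak{T}_{\mathcal{I}}$ is a topology on $\mathbb{R}$ finer than the density topology $\mathfrak{T}_d$, i.e. $\mathfrak{T}_d\subset\mathfrak{T}_{\mathcal{I}}$.
   Context: $m$ denotes Lebesgue measure on $\mathbb{R}$. An ideal $\mathcal{I}$ of subsets of $\mathbb{N}=\{1,2,\dots\}$ is a nonempty family closed under finite unions and under subsets; it is nontrivial if $\mathcal{I}\neq\{\emptyset\}$ and $\mathbb{N}\notin\mathcal{I}$, and admissible if it contains all singletons. $\mathcal{F}(\mathcal{I})=\{M\subset\mathbb{N}:\mathbb{N}\setminus M\in\mathcal{I}\}$. For a bounded real sequence $x=(x_n)$: $\mathcal{I}\text{-}\liminf x=\inf\{a\in\mathbb{R}:\{k:x_k<a\}\notin\mathcal{I}\}$. Let $E\subset\mathbb{R}$ be Lebesgue measurable and $p\in\mathbb{R}$. Consider sequences $(J_n)_{n\in\mathbb{N}}$ of closed intervals with $p\in J_n$ for all $n$ and $\{n\in\mathbb{N}:0<m(J_n)<\frac1n\}\in\mathcal{F}(\mathcal{I})$. For such a sequence put $x_n=\frac{m(J_n\cap E)}{m(J_n)}$ (with $x_n:=0$ if $m(J_n)\in\{0,\infty\}$; such $n$ form a set in $\mathcal{I}$ and do not matter). The lower $\mathcal{I}$-density $\mathcal{I}\text{-}d_-(p,E)$ is the infimum of $\mathcal{I}\text{-}\liminf x_n$ over all such sequences $(J_n)$. $\mathfrak{T}_{\mathcal{I}}$ is the collection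 of Lebesgue measurable sets $A\subset\mathbb{R}$ with $\mathcal{I}\text{-}d_-(x,A)=1$ for all $x\in A$. Ordinary density topology: $\mathfrak{T}_d$ is the collection of Lebesgue measurable $E\subset\mathbb{R}$ such that $d(x,E)=1$ for all $x\in E$, where $d(x,E)=\gamma$ means that the upper density $\lim_{n\to\infty}\sup\{\frac{m(E\cap I)}{m(I)}: I\text{ closed interval},x\in I,0<m(I)<\frac1n\}$ and the lower density $\lim_{n\to\infty}\inf\{\frac{m(E\cap I)}{m(I)}: I\text{ closed interval},x\in I,0<m(I)<\frac1n\}$ both equal $\gamma$. *)

(* Defs.v *)
From HB Require Import structures.
From mathcomp Require Import all_boot all_order all_algebra.
From mathcomp Require Import all_classical all_reals all_analysis.
Set Implicit Arguments.
Unset Strict Implicit.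
Unset Printing Implicit Defensive.
Import Order.TTheory GRing.Theory Num.Theory.
Import numFieldNormedType.Exports.
Local Open Scope classical_set_scope.
Local Open Scope ring_scope.

Section Ideals.
Context {T : Type}.
Implicit Types I : set_system T.

Definition is_ideal I :=
  [/\ I !=set0, setU_closed I & forall A B, A `<=` B -> I B -> I A].

Definition nontrivial_ideal I := I <> [set set0] /\ ~ I setT.

Definition admissible_ideal I := forall x, I [set x].

Definition dual_filter I : set_system T := [set M | I (~` M)].

End Ideals.

Definition is_topology (T : Type) (op : set_system T) :=
  [/\ op set0, op setT, setI_closed op &
      forall G : set_system T, G `<=` op -> op (\bigcup_(A in G) A)].

(* The index set {1, 2, ...} is represented by nat, with k : nat standing for
   the integer k + 1. An ideal on {1, 2, ...} is thus a set_system nat, a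
   sequence (x_n)_{n >= 1} is a function on nat, and the bound 1/n becomes
   k.+1%:R^-1. *)

Definition ideal_liminf (R : realType) (I : set_system nat) (x : nat -> R) :
    \bar R :=
  ereal_inf [set a%:E | a in [set a : R | ~ I [set k | x k < a]]].

Section Density.
Context {R : realType}.
Implicit Types (E J : set R) (p : R) (I : set_system nat).

(* Measurability is in the Caratheodory (complete) sigma-algebra, not in the
   Borel one carried by R. *)
Definition lebesgue_measurable E :=
  ((wlength (@idfun R))^*)%mu.-cara.-measurable E.

Local Notation m := (@completed_lebesgue_measure R).

(* Closed rays, R itself and singletons are included. *)
Definition closed_interval J := closed J /\ is_interval J.

(* This is 0 when m J is 0 or +oo, since fine +oo = 0 and 0^-1 = 0. *)
Definition density_ratio E J : R := fine (m (J `&` E)) / fine (m J).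

Definition shrinking_intervals I p (J : nat -> set R) :=
  (forall k, closed_interval (J k) /\ J k p) /\
  dual_filter I [set k | 0 < m (J k) < (k.+1%:R^-1)%:E]%E.

Definition ideal_lower_density I p E : \bar R :=
  ereal_inf [set ideal_liminf I (fun k => density_ratio E (J k)) |
             J in shrinking_intervals I p].

Definition ideal_density_topology I : set_system R :=
  [set A | lebesgue_measurable A /\
           forall x, A x -> ideal_lower_density I x A = 1%E].

Definition small_intervals p (k : nat) : set (set R) :=
  [set J | [/\ closed_interval J, J p & (0 < m J < (k.+1%:R^-1)%:E)%E]].

Definition upper_density p E : \bar R :=
  limn (fun k => ereal_sup [set (density_ratio E J)%:E |
                            J in small_intervals p k]).

Definition lower_density p E : \bar R :=
  limn (fun k => ereal_inf [set (density_ratio E J)%:E |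
                            J in small_intervals p k]).

Definition has_density p E (gamma : R) :=
  upper_density p E = gamma%:E /\ lower_density p E = gamma%:E.

Definition density_topology : set_system R :=
  [set E | lebesgue_measurable E /\ forall x, E x -> has_density x E 1].

End Density.
Arguments ideal_density_topology : clear implicits.
Arguments density_topology : clear implicits.

(* Main.v *)
Require Import Defs.
From mathcomp Require Import all_boot all_order all_algebra.
From mathcomp Require Import all_classical all_reals all_analysis.
From mathcomp Require Import measurable_realfun lra.

(** Since ratios never exceed 1 and N is not in I, [ideal_lower_density_eq1P]
    turns the condition that the lower I-density of E at p is 1 into: for every
    admissible sequence (J_n) at p and every a < 1, the set of n where the ratio
    of E in J_n is below a belongs to I. In this form, stability under finite
    intersections follows from the inequality
    ratio(A) + ratio(B) <= 1 + ratio(A /\ B) ([density_ratioI]), and every point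
    of a union inherits the condition from any member that contains it, by
    monotonicity. An ordinary density point satisfies the condition because the
    ratio is then above a for all sufficiently short intervals around the point,
    so that the exceptional indices are finitely many, up to a set of I.

    The one substantial point is that an arbitrary union W of sets of the
    family is Lebesgue measurable. Take a Borel set V inside W of maximal measure,
    in the sense that every measurable A inside W satisfies m(A \ V) = 0
    ([inner_kernel]). A point p of W \ V lies in some member A of the family;
    since A is contained in V up to a null set, V also has lower I-density 1 at
    p. By the Lebesgue density theorem V has density 0 at almost every point
    outside V, and already along the centred intervals of length 1/(2n) this
    excludes lower I-density 1, as it would force N to be in I
    ([density_ratio_centered]). Hence W \ V is null, and W is measurable because
    the measure is complete. *)

Local Open Scope classical_set_scope.

Section IdealDensity.
Set Implicit Arguments.
Unset Strict Implicit.
Import Order.TTheory GRing.Theory Num.Theory.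
Import numFieldNormedType.Exports.
Local Open Scope ring_scope.

(** * Ideals *)
Section Ideals.
Context {T : Type}.
Variable I : set_system T.
Hypothesis I_ideal : is_ideal I.

Lemma ideal_sub A B : A `<=` B -> I B -> I A.
Proof. by case: I_ideal => _ _; apply. Qed.

Lemma idealU A B : I A -> I B -> I (A `|` B).
Proof. by case: I_ideal => _ + _; apply. Qed.

Lemma ideal_set0 : I set0.
Proof. by case: I_ideal => -[A IA] _ /(_ set0 A); apply. Qed.

End Ideals.

Lemma ideal_initial (I : set_system nat) n :
  is_ideal I -> admissible_ideal I -> I `I_n.
Proof.
move=> I_ideal I_admissible; elim: n => [|n IHn].
  by rewrite II0; exact: ideal_set0.
by rewrite IIS; exact: idealU.
Qed.

Context {R : realType}.
Implicit Types (A B E V W J : set R) (p : R) (I : set_system nat).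

Local Notation m := (@completed_lebesgue_measure R).
Local Notation om := ((wlength (@idfun R))^*)%mu.

(** * The completed Lebesgue measure and density ratios *)

(** The completed measure is the restriction of an outer measure defined on all
    sets; monotonicity and subadditivity therefore need no measurability. *)
Lemma le_completed_measure A B : A `<=` B -> (m A <= m B)%E.
Proof. exact: (le_outer_measure om). Qed.

Lemma completed_measure_ge0 A : (0 <= m A)%E.
Proof. exact: (outer_measure_ge0 om). Qed.

Lemma completed_measureU_le A B : (m (A `|` B) <= m A + m B)%E.
Proof. exact: (outer_measureU2 om). Qed.

(** Caratheodory's criterion: the test set A is arbitrary. *)
Lemma completed_measure_split A B : lebesgue_measurable B ->
  m A = (m (A `&` B) + m (A `&` ~` B))%E.
Proof. by move=> mB; exact: mB. Qed.

Lemma Borel_lebesgue_measurable A :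
  measurable (A : set (measurableTypeR R)) -> lebesgue_measurable A.
Proof. exact: sub_caratheodory. Qed.

(** If m(J) is infinite both ratios are 0 by convention; otherwise all measures
    involved are finite and [fine] preserves the order. *)
Lemma le_density_ratio A B J : (m (J `&` A) <= m (J `&` B))%E ->
  density_ratio A J <= density_ratio B J.
Proof.
move=> AB; rewrite /density_ratio.
have [->|Joo] := eqVneq (m J) +oo%E; first by rewrite /= invr0 !mulr0.
have fJ C : m (J `&` C) \is a fin_num.
  rewrite ge0_fin_numE ?completed_measure_ge0//.
  apply: (@le_lt_trans _ _ (m J)).
    by apply: le_completed_measure; exact: subIsetl.
  by rewrite ltey.
rewrite ler_wpM2r ?invr_ge0 ?fine_ge0 ?completed_measure_ge0//.
by apply: fine_le.
Qed.

Lemma density_ratioT J : (0 < m J < +oo)%E -> density_ratio [set: R] J = 1.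
Proof.
move=> /andP[J0 Joo]; rewrite /density_ratio setIT divff// gt_eqF//.
by rewrite fine_gt0// J0.
Qed.

Lemma density_ratio_le1 E J : density_ratio E J <= 1.
Proof.
apply: (@le_trans _ _ (density_ratio [set: R] J)).
  by apply: le_density_ratio; apply: le_completed_measure; exact: setIS.
rewrite /density_ratio setIT.
by have [->|?] := eqVneq (fine (m J)) 0; rewrite ?mul0r ?ler01 ?divff.
Qed.

(** For intersections with A, discarding a null part of A costs nothing; so V
    inherits the I-density of a set that it contains up to a null set. *)
Lemma density_ratio_null A V J : m (A `\` V) = 0%E ->
  density_ratio A J <= density_ratio V J.
Proof.
move=> AV0; apply: le_density_ratio.
apply: (@le_trans _ _ (m (J `&` V `|` A `\` V))).
  apply: le_completed_measure => x [Jx Ax].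
  by have [Vx|nVx] := pselect (V x); [left|right].
by rewrite (le_trans (completed_measureU_le _ _))// AV0 adde0.
Qed.

(** Inclusion-exclusion inside J: the part of J /\ A that misses B has measure at
    most m(J) - m(J /\ B). *)
Lemma density_ratioI A B J : lebesgue_measurable B -> (0 < m J < +oo)%E ->
  density_ratio A J + density_ratio B J <= 1 + density_ratio (A `&` B) J.
Proof.
move=> mB /andP[J0 Joo].
have fJ C : C `<=` J -> m C \is a fin_num.
  move=> CJ; rewrite ge0_fin_numE ?completed_measure_ge0//.
  by rewrite (le_lt_trans _ Joo)//; exact: le_completed_measure.
have J0' : 0 < fine (m J) by rewrite fine_gt0// J0.
rewrite /density_ratio -mulrDl ler_pdivrMr// mulrDl mul1r divfK ?gt_eqF//.
have := completed_measure_split (J `&` A) mB.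
have := completed_measure_split J mB.
rewrite -setIA.
set a := m (J `&` B); set b := m (J `&` ~` B).
set c := m (J `&` (A `&` B)); set d := m (J `&` A `&` ~` B).
have fa : a \is a fin_num by apply: fJ.
have fb : b \is a fin_num by apply: fJ.
have fc : c \is a fin_num by apply: fJ.
have fd : d \is a fin_num by apply: fJ => x [[]].
have : (d <= b)%E by apply: le_completed_measure => x [[]].
move=> /(fine_le fd fb) db -> ->; rewrite !fineD//; lra.
Qed.

(** * Sequences of intervals and the density condition *)
Lemma centered_intervals_measure p (r : R) : 0 < r ->
  m `[p - r, p + r] = (r *+ 2)%:E.
Proof.
move=> r0; rewrite -closed_ball_itv//.
by have := @lebesgue_measure_closed_ball R p r (ltW r0).
Qed.

(** The radius is chosen so that the length is 1/(2(k+1)), strictly less than the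
    bound 1/(k+1). *)
Definition centered_intervals p (k : nat) : set R :=
  `[p - k.+1%:R^-1 / 4, p + k.+1%:R^-1 / 4]%classic.

Lemma shrinking_centered_intervals I p : is_ideal I ->
  shrinking_intervals I p (centered_intervals p).
Proof.
move=> I_ideal; have k0 (k : nat) : 0 < k.+1%:R^-1 :> R by rewrite invr_gt0.
split=> [k|].
  split; last first.
    rewrite /centered_intervals /= in_itv /=; move: (k.+1%:R^-1) (k0 k) => r r0.
    by apply/andP; split; lra.
  by split; [exact: itv_closed|exact: interval_is_interval].
rewrite /dual_filter /=; apply: (ideal_sub I_ideal (B := set0)); last first.
  exact: ideal_set0.
move=> k /=; case; rewrite centered_intervals_measure; last first.
  by rewrite divr_gt0.
by rewrite !lte_fin; move: (k.+1%:R^-1) (k0 k) => r r0; apply/andP; split; lra.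
Qed.

(** A value below 1 of the infimum is witnessed by some sequence (J_n) and some
    a < 1 whose index set is outside I. The infimum cannot exceed 1 because some
    admissible sequence exists and no ratio exceeds 1: for a > 1 the index set is
    all of N, which is not in I. *)
Lemma ideal_lower_density_eq1P I p E : is_ideal I -> ~ I setT ->
  ideal_lower_density I p E = 1%E <->
  (forall J : nat -> set R, shrinking_intervals I p J ->
   forall a, a < 1 -> I [set k | density_ratio E (J k) < a]).
Proof.
move=> I_ideal I_proper; split=> [E1 J pJ a a1|E1].
  apply: contrapT => nIa.
  have : (1 <= a%:E)%E; last by rewrite lee_fin leNgt a1.
  rewrite -E1; apply: (@le_trans _ _
      (ideal_liminf I (fun k => density_ratio E (J k)))).
    by apply: ereal_inf_lbound; exists J.
  by apply: ereal_inf_lbound; exists a.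
apply/eqP; rewrite eq_le; apply/andP; split; last first.
  apply: le_ereal_inf_tmp => _ [J pJ <-].
  apply: le_ereal_inf_tmp => _ [a /= nIa <-].
  by rewrite lee_fin leNgt; apply/negP => /(E1 _ pJ).
apply: (@le_trans _ _ (ideal_liminf I
    (fun k => density_ratio E (centered_intervals p k)))).
  apply: ereal_inf_lbound; exists (centered_intervals p) => //.
  exact: shrinking_centered_intervals.
apply/lee_addgt0Pr => e e0; apply: ereal_inf_lbound; exists (1 + e) => //=.
suff -> : [set k | density_ratio E (centered_intervals p k) < 1 + e] = setT.
  by [].
apply/seteqP; split=> // k _ /=.
by rewrite (le_lt_trans (density_ratio_le1 _ _))// ltrDl.
Qed.

(** * Measurability of unions *)

(** A subset of W of maximal measure, obtained from a G-delta hull H_n of the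
    bounded set (~ W) /\ ball 0 n by removing H_n from that ball. If A is a
    measurable subset of W, then H_n \ A still covers (~ W) /\ ball 0 n, so that
    m(H_n) <= m(H_n \ A), and the finiteness of m(H_n) gives m(H_n /\ A) = 0.
    That V is Borel makes the Lebesgue density theorem applicable to it. *)
Lemma inner_kernel W : exists V,
  [/\ measurable (V : set (measurableTypeR R)), V `<=` W &
      forall A, lebesgue_measurable A -> A `<=` W -> m (A `\` V) = 0%E].
Proof.
have Hex n : exists H : set R, [/\ measurable (H : set (measurableTypeR R)),
    ~` W `&` ball 0 n%:R `<=` H &
    m H = m (~` W `&` ball 0 n%:R)].
  have [G [oG WG mG]] := outer_measure_Gdelta (~` W `&` ball 0 n%:R).
  exists (\bigcap_i G i); split => //.
  by apply: bigcapT_measurable => i; exact: open_measurable.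
pose H n := sval (cid (Hex n)).
have mH n : measurable (H n : set (measurableTypeR R)).
  by rewrite /H; case: cid => ? [].
have WH n : ~` W `&` ball 0 n%:R `<=` H n by rewrite /H; case: cid => ? [].
have HE n : m (H n) = m (~` W `&` ball 0 n%:R).
  by rewrite /H; case: cid => ? [].
exists (\bigcup_n (ball 0 n%:R `\` H n)); split.
- apply: bigcupT_measurable => n; apply: measurableD => //.
  exact: measurable_ball.
- move=> x [n _ [xn nHx]]; apply: contrapT => nWx.
  by apply: nHx; apply: WH.
move=> A mA AW.
have AH n : m (H n `&` A) = 0%E.
  have fH : m (H n) \is a fin_num.
    rewrite ge0_fin_numE ?completed_measure_ge0// HE.
    apply: (@le_lt_trans _ _ (m (ball 0 n%:R))).
      by apply: le_completed_measure; exact: subIsetr.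
    by rewrite [m _]lebesgue_measure_ball// ltry.
  have : (m (H n) <= m (H n `&` ~` A))%E.
    rewrite {1}HE; apply: le_completed_measure => x [nWx xn].
    by split; [exact: WH|move/AW].
  have fC C : m (H n `&` C) \is a fin_num.
    rewrite ge0_fin_numE ?completed_measure_ge0//.
    apply: (@le_lt_trans _ _ (m (H n))).
      by apply: le_completed_measure; exact: subIsetl.
    by rewrite -ge0_fin_numE ?completed_measure_ge0.
  rewrite {1}(completed_measure_split (H n) mA) -[leRHS]add0e leeD2rE//.
  by move=> AH; apply/eqP; rewrite eq_le AH completed_measure_ge0.
apply/eqP; rewrite eq_le completed_measure_ge0 andbT.
apply: (@le_trans _ _ (m (\bigcup_n (H n `&` A)))).
  apply: le_completed_measure => x [Ax nVx]; pose n := Num.bound `|x|.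
  have xn : ball (0 : R) n%:R x.
    by rewrite /ball /= sub0r normrN archi_boundP.
  exists n => //; split=> //; apply: contrapT => nHx.
  by apply: nVx; exists n.
apply: (le_trans (outer_measure_sigma_subadditive om _)).
by rewrite eseries0// => n _ _; exact: AH.
Qed.

(** The k-th centred interval lies in the ball of twice its radius, whose measure
    is twice as large. A ratio below 1/4 in these balls thus gives a ratio below
    1/2 in the intervals. *)
Lemma density_ratio_centered V p :
  (lebesgue_measure (V `&` ball p r) * (lebesgue_measure (ball p r))^-1
      @[r --> 0^'+] --> 0)%E ->
  \forall k \near \oo, density_ratio V (centered_intervals p k) < 2^-1.
Proof.
have q0 : (0 < (4^-1)%:E :> \bar R)%E by rewrite lte_fin invr_gt0.
move=> /(_ _ (open_ereal_lt' q0)) [_/posnumP[e] /= Ve].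
apply: filterS (near_infty_natSinv_lt e) => k ke.
have k0 : 0 < k.+1%:R^-1 :> R by rewrite invr_gt0.
have JE := centered_intervals_measure p (divr_gt0 k0 (ltr0n _ 4)).
have Jball : centered_intervals p k `<=` ball p (k.+1%:R^-1 / 2).
  move=> x; rewrite /centered_intervals ball_itv /= !in_itv /=.
  move: (k.+1%:R^-1) k0 => r r0 /andP[? ?]; apply/andP; split; lra.
rewrite -/(centered_intervals p k) in JE.
move: (k.+1%:R^-1) k0 ke JE Jball => r r0 re JE Jball.
have r20 : 0 < r / 2 :> R by lra.
have := Ve (r / 2); rewrite /= sub0r normrN gtr0_norm//.
move=> /(_ _ r20).
have mb : lebesgue_measure (ball p (r / 2)) = r%:E :> \bar R.
  by rewrite lebesgue_measure_ball ?ltW// mulr2n; congr EFin; lra.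
have fV : m (V `&` ball p (r / 2)) \is a fin_num.
  rewrite ge0_fin_numE ?completed_measure_ge0//.
  apply: (@le_lt_trans _ _ (m (ball p (r / 2)))).
    by apply: le_completed_measure; exact: subIsetr.
  by rewrite [m _]mb ltry.
rewrite mb inver gt_eqF// -[X in (X * _)%E](fineK fV) -EFinM lte_fin.
have re2 : r / 2 < e%:num by lra.
move=> /(_ re2); rewrite ltr_pdivrMr// => Vk.
rewrite /density_ratio JE /= ltr_pdivrMr; last by rewrite mulrn_wgt0// divr_gt0.
apply: (@le_lt_trans _ _ (fine (m (V `&` ball p (r / 2))))).
  apply: fine_le => //; last by apply: le_completed_measure => x [/Jball].
  rewrite ge0_fin_numE ?completed_measure_ge0//.
  apply: (@le_lt_trans _ _ (m (centered_intervals p k))).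
    by apply: le_completed_measure; exact: subIsetl.
  by rewrite JE ltry.
by apply: (lt_le_trans Vk); rewrite (mulr2n (r / 4)); lra.
Qed.

(** At a point of W \ V where V has density 0, the set of indices with ratio of A
    below 1/2 is cofinite; it is also in I because A has lower I-density 1 there,
    so N would be in I. Such points therefore do not exist, and W \ V lies in the
    null set where the density theorem fails for V. *)
Lemma ideal_density_topology_bigcup_measurable I (G : set_system R) :
  is_ideal I -> admissible_ideal I -> ~ I setT ->
  G `<=` ideal_density_topology R I -> lebesgue_measurable (\bigcup_(A in G) A).
Proof.
move=> I_ideal I_admissible I_proper GI; set W := \bigcup_(A in G) A.
have [V [mV VW Vmax]] := inner_kernel W.
have [N [mN N0 Nbad]] := lebesgue_density mV.
have WVN : W `\` V `<=` N.
  move=> p [[A GA Ap] nVp]; apply: Nbad => /=; rewrite indicE memNset// => Vp.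
  have [mA /(_ p Ap) /ideal_lower_density_eq1P A1] := GI A GA.
  have AV0 : m (A `\` V) = 0%E by apply: Vmax => // x Ax; exists A.
  have half1 : 2^-1 < 1 :> R by lra.
  have [K _ VK] := density_ratio_centered Vp.
  apply: (I_proper); apply: (ideal_sub I_ideal) (idealU I_ideal
    (ideal_initial K I_ideal I_admissible)
    (A1 I_ideal I_proper _ (shrinking_centered_intervals p I_ideal) _ half1)).
  move=> k _; have [kK|Kk] := ltnP k K; [by left|right => /=].
  exact: le_lt_trans (density_ratio_null _ AV0) (VK k Kk).
rewrite -(setDUK VW).
apply: measurableU; first exact: Borel_lebesgue_measurable.
apply: completed_lebesgue_measure_is_complete; exists N; split => //.
exact: Borel_lebesgue_measurable.
Qed.

(** * The topology and its comparison with the density topology *)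
Lemma ideal_density_topology_is_topology I : is_ideal I ->
  admissible_ideal I -> ~ I setT -> is_topology (ideal_density_topology R I).
Proof.
move=> I_ideal I_admissible I_proper; split.
- by split=> //; apply: Borel_lebesgue_measurable; exact: measurable0.
- split; first by apply: Borel_lebesgue_measurable; exact: measurableT.
  move=> p _; apply/ideal_lower_density_eq1P => // J [_ pJ] a a1.
  apply: (ideal_sub I_ideal) pJ => k /= + /andP[J0 Jk].
  rewrite density_ratioT; first by move=> /lt_trans/(_ a1); rewrite ltxx.
  by rewrite J0 (lt_trans Jk)// ltry.
- move=> A B [mA A1] [mB B1]; split; first exact: measurableI.
  move=> p [/A1/ideal_lower_density_eq1P {}A1].
  move=> /B1/ideal_lower_density_eq1P {}B1.
  apply/ideal_lower_density_eq1P => // J pJ a a1.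
  (* If both ratios are at least (1 + a) / 2, then that of the intersection is
     at least a. *)
  have b1 : (1 + a) / 2 < 1 by lra.
  apply: (ideal_sub I_ideal) (idealU I_ideal pJ.2
    (idealU I_ideal (A1 I_ideal I_proper _ pJ _ b1)
                    (B1 I_ideal I_proper _ pJ _ b1))).
  move=> k /= ABa.
  have [Jk|] := pselect (0 < m (J k) < (k.+1%:R^-1)%:E)%E; last by left.
  right; apply: contrapT => /not_orP[] /negP + /negP; rewrite -!leNgt.
  have /andP[J0 Joo] := Jk.
  have := @density_ratioI A B (J k) mB.
  by rewrite J0 (lt_trans Joo (ltry _)) => /(_ isT); lra.
- move=> G GI; split.
    exact: ideal_density_topology_bigcup_measurable I_ideal _ _ GI.
  move=> p [A GA Ap]; have [_ /(_ p Ap)] := GI A GA.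
  move/ideal_lower_density_eq1P => A1.
  apply/ideal_lower_density_eq1P => // J pJ a a1.
  apply: (ideal_sub I_ideal) (A1 I_ideal I_proper _ pJ _ a1) => k /=.
  apply: le_lt_trans; apply: le_density_ratio; apply: le_completed_measure.
  by apply: setIS; exact: bigcup_sup.
Qed.

(** The infima over intervals shorter than 1/(k+1) increase with k, so their limit
    1 exceeds a only if one of them, say the k-th, does. From that index on, the
    intervals of the sequence that satisfy the length condition have ratio above
    a. *)
Lemma density_topology_sub I : is_ideal I ->
  admissible_ideal I -> ~ I setT ->
  density_topology R `<=` ideal_density_topology R I.
Proof.
move=> I_ideal I_admissible I_proper E [mE E1]; split=> // p /E1[_ {}E1].
apply/ideal_lower_density_eq1P => // J pJ a a1.
pose u k := ereal_inf [set (density_ratio E J)%:E | J in small_intervals p k].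
have [k ak] : exists k, (a%:E < u k)%E.
  apply: contrapT => /forallNP ua.
  suff : (1 <= a%:E)%E by rewrite lee_fin leNgt a1.
  rewrite -E1; apply: lime_le; last first.
    by apply: nearW => k; rewrite leNgt; apply/negP; exact: ua.
  apply: ereal_nondecreasing_is_cvgn => k l kl; apply: ereal_inf_le_tmp.
  apply: image_subset => K [cK pK /andP[K0 Kl]]; split=> //; rewrite K0/=.
  by rewrite (lt_le_trans Kl)// lee_fin lef_pV2 ?posrE// ler_nat.
apply: (ideal_sub I_ideal) (idealU I_ideal pJ.2
  (ideal_initial k I_ideal I_admissible)).
move=> l /= Ea.
have [Jl|] := pselect (0 < m (J l) < (l.+1%:R^-1)%:E)%E; last by left.
right; rewrite ltnNge; apply/negP => kl.
suff : (u k <= (density_ratio E (J l))%:E)%E.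
  by move=> /(lt_le_trans ak); rewrite lte_fin => /(lt_trans Ea); rewrite ltxx.
apply: ereal_inf_lbound; exists (J l) => //.
have [cJ pJl] := pJ.1 l; split=> //; move/andP: Jl => [-> Jl] /=.
by rewrite (lt_le_trans Jl)// lee_fin lef_pV2 ?posrE// ler_nat.
Qed.

End IdealDensity.

Theorem theorem4p3 (R : realType) (I : set_system nat)
    (I_ideal : is_ideal I) (I_nontrivial : nontrivial_ideal I)
    (I_admissible : admissible_ideal I) :
  is_topology (ideal_density_topology R I) /\
  density_topology R `<=` ideal_density_topology R I.
Proof.
have [_ I_proper] := I_nontrivial; split.
  exact: ideal_density_topology_is_topology.
exact: density_topology_sub.
Qed.
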